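(* Let $G$ be a simple graph on $n$ vertices with adjacency matrix $A$ and walk-matrix $W$, and let $d=\gcd\left(\frac{\det(W)}{2^{\lfloor n/2\rfloor}},\Delta_A\right)$. If $d$ is odd and square-free, then $G$ is determined by the generalized spectrum (DGS).
   Context: The walk-matrix of $G$ is $W=[e,Ae,\dots,A^{n-1}e]$, where $e$ is the all-ones vector of length $n$; the number $\det(W)/2^{\lfloor n/2\rfloor}$ is always an integer. Let $\phi(x)=\det(xI-A)$, with roots $\alpha_1,\dots,\alpha_n\in\mathbb{C}$ (with multiplicity); the discriminant of $A$ is the integer $\Delta_A=\prod_{i<j}(\alpha_i-\alpha_j)^2=\pm\operatorname{Res}(\phi,\phi')$, where $\operatorname{Res}$ denotes the resultant. The spectrum $\sigma(G)$ is the multiset of eigenvalues of the adjacency matrix of $G$, and $\bar G$ denotes the complement of $G$. The graph $G$ is determined by the generalized spectrum (DGS) if, for every graph $H$, $\sigma(G)=\sigma(H)$ and $\sigma(\bar G)=\sigma(\bar H)$ imply that $H$ is isomorphic to $G$. *)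

(* Defs.v *)
From mathcomp Require Import all_boot all_order all_algebra all_field.
From mathcomp Require Import spectral ring lra zify.

Set Implicit Arguments.
Unset Strict Implicit.
Unset Printing Implicit Defensive.

Import Order.TTheory GRing.Theory Num.Theory.

Local Open Scope ring_scope.

Record sgraph (n : nat) := SGraph {
  edge : rel 'I_n;
  edge_sym : symmetric edge;
  edge_irr : irreflexive edge
}.

Definition isomorphic n m (G : sgraph n) (H : sgraph m) : Prop :=
  exists2 f : 'I_n -> 'I_m,
    bijective f & forall u v, edge H (f u) (f v) = edge G u v.

Section Complement.
Variables (n : nat) (G : sgraph n).

Definition compl_edge : rel 'I_n := fun u v => (u != v) && ~~ edge G u v.

Lemma compl_edge_sym : symmetric compl_edge.
Proof. by move=> u v; rewrite /compl_edge eq_sym edge_sym. Qed.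

Lemma compl_edge_irr : irreflexive compl_edge.
Proof. by move=> u; rewrite /compl_edge eqxx. Qed.

Definition compl : sgraph n := SGraph compl_edge_sym compl_edge_irr.

End Complement.

Definition adjacency n (G : sgraph n) : 'M[int]_n :=
  \matrix_(u, v) (edge G u v)%:R.

Definition walk_matrix n (G : sgraph n) : 'M[int]_n :=
  \matrix_(u, k) (adjacency G ^+ k *m const_mx 1 : 'cV[int]_n) u 0.

(* The complex roots of the characteristic polynomial, listed with
   multiplicity in an unspecified order; they are algebraic numbers. *)
Definition eigenvalues n (A : 'M[int]_n) : seq algC :=
  sval (closed_field_poly_normal (map_poly intr (char_poly A))).

(* [Num.floor] reads a product that is an integer as an element of [int]:
   see [discriminantE] below. *)
Definition discriminant n (A : 'M[int]_n) : int :=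
  let a := eigenvalues A in
  Num.floor (\prod_(j < n) \prod_(i < j) (a`_i - a`_j) ^+ 2).

(* Multisets are sequences up to [perm_eq]. *)
Definition spectrum n (G : sgraph n) : seq algC := eigenvalues (adjacency G).

(* [H] may have any number of vertices, not only [n]. *)
Definition dgs n (G : sgraph n) : Prop :=
  forall m (H : sgraph m),
    perm_eq (spectrum G) (spectrum H) ->
    perm_eq (spectrum (compl G)) (spectrum (compl H)) ->
    isomorphic H G.

(* 0 is not square-free. *)
Definition squarefree (d : nat) : Prop :=
  forall m : nat, (m ^ 2 %| d)%N -> m = 1%N.

(* The division is exact: see [det_walk_matrix_dvd] below. *)
Definition walk_quotient n (G : sgraph n) : int :=
  (\det (walk_matrix G) %/ 2 ^+ n./2)%Z.

Section Facts.
Variables (n : nat) (G : sgraph n).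
Let A := adjacency G.
Let e : 'cV[int]_n := const_mx 1.

Lemma adjacency_tr : A^T = A.
Proof. by apply/matrixP=> i j; rewrite !mxE edge_sym. Qed.

Lemma adjacencyX_tr k : (A ^+ k)^T = A ^+ k.
Proof.
elim: k => [|k IH]; first by rewrite !expr0 trmx1.
by rewrite exprS trmx_mul IH adjacency_tr -[_ *m _]/(_ * _) -exprSr exprS.
Qed.

Lemma eigenvaluesE (B : 'M[int]_n) :
  map_poly intr (char_poly B) = \prod_(z <- eigenvalues B) ('X - z%:P).
Proof.
rewrite /eigenvalues; case: closed_field_poly_normal => s /= Hs.
rewrite {1}Hs; suff -> : lead_coef (map_poly (intr : int -> algC) (char_poly B)) = 1
  by rewrite scale1r.
by apply/monicP; apply: monic_map; apply: char_poly_monic.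
Qed.

Lemma size_eigenvalues (B : 'M[int]_n) : size (eigenvalues B) = n.
Proof.
have := congr1 (size \o polyseq) (eigenvaluesE B) => /=.
rewrite size_prod_XsubC size_map_poly_id0 ?size_char_poly; first by case.
by rewrite (monicP (char_poly_monic B)) oner_eq0.
Qed.

Let Ac : 'M[algC]_n := map_mx intr A.

Let Ac_normal : Ac \is normalmx.
Proof.
have EAc : (Ac ^t* )%sesqui = Ac.
  by apply/matrixP=> i j; rewrite !mxE edge_sym rmorph_int.
by apply/normalmxP; rewrite EAc.
Qed.

Lemma adjacency_trace k :
  \sum_(z <- eigenvalues A) z ^+ k = (\tr (A ^+ k))%:~R.
Proof.
have E := orthomx_spectralP Ac_normal.
set P := spectralmx Ac in E; set d := spectral_diag Ac in E.
have Pu : P \in unitmx by apply: spectral_unit.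
have Ek : map_mx intr (A ^+ k) =
          invmx P *m diag_mx (\row_j (d 0 j) ^+ k) *m P.
  elim: k => [|k IH].
    rewrite expr0 map_mx1; suff -> : diag_mx (\row_j d 0 j ^+ 0) = 1%:M.
      by rewrite mulmx1 mulVmx.
    by apply/matrixP=> i j; rewrite !mxE expr0.
  rewrite exprS -[A * _]/(A *m _) map_mxM IH -/Ac E !mulmxA mulmxK //.
  congr (_ *m _); rewrite -!mulmxA; congr (_ *m _); rewrite mulmx_diag.
  by congr diag_mx; apply/rowP=> j; rewrite !mxE exprS.
have Pe : perm_eq (eigenvalues A) [seq d 0 j | j : 'I_n].
  apply: prod_XsubC_eq; rewrite -eigenvaluesE map_char_poly -/Ac.
  rewrite big_image /= E.
  have -> : char_poly (invmx P *m diag_mx d *m P) = char_poly (diag_mx d).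
    rewrite /char_poly.
    have -> : char_poly_mx (invmx P *m diag_mx d *m P) =
        map_mx polyC (invmx P) *m char_poly_mx (diag_mx d) *m map_mx polyC P.
      rewrite /char_poly_mx !map_mxM mulmxBr mulmxBl scalar_mxC -[X in _ = X - _]mulmxA.
      by rewrite -[map_mx _ (invmx P) *m map_mx _ P]map_mxM mulVmx // map_mx1 mulmx1.
    rewrite !det_mulmx mulrAC -det_mulmx -map_mxM mulVmx // map_mx1 det1.
    by rewrite mul1r.
  rewrite char_poly_trig ?diag_mx_is_trig //.
  by apply: eq_bigr => i _; rewrite mxE eqxx.
rewrite (perm_big _ Pe) /= big_image /= -trace_map_mx Ek mxtrace_mulC mulmxA.
rewrite mulmxV // mul1mx mxtrace_diag.
by apply: eq_bigr => j _; rewrite mxE.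
Qed.

Lemma discriminantE :
  (discriminant A)%:~R =
  \prod_(j < n) \prod_(i < j) ((eigenvalues A)`_i - (eigenvalues A)`_j) ^+ 2.
Proof.
rewrite /discriminant; apply: floorK.
set a := eigenvalues A; have sza : size a = n by apply: size_eigenvalues.
pose V := Vandermonde n (\row_(i < n) a`_i).
have -> : \prod_(j < n) \prod_(i < j) (a`_i - a`_j) ^+ 2 = \det (V *m V^T).
  rewrite det_mulmx det_tr det_Vandermonde -expr2 (exchange_big_dep predT) //=.
  rewrite -prodrXl; apply: eq_bigr => j _; rewrite -prodrXl.
  rewrite (big_ord_widen n (fun i => (a`_i - a`_j) ^+ 2)); last exact/ltnW.
  by apply: eq_bigr => i _; rewrite !mxE -opprB sqrrN.
have -> : V *m V^T = map_mx intr (\matrix_(i < n, j < n) \tr (A ^+ (i + j))).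
  apply/matrixP=> i j; rewrite !mxE -adjacency_trace -/a (big_nth 0) sza big_mkord.
  by apply: eq_bigr => k _; rewrite !mxE exprD.
by rewrite det_map_mx intr_int.
Qed.

Let w k : 'cV[int]_n := A ^+ k *m e.
Let s k : int := \sum_u w k u 0.

Let wE i j : \sum_u w i u 0 * w j u 0 = s (i + j).
Proof.
have E : (w i)^T *m w j = e^T *m w (i + j).
  by rewrite /w trmx_mul adjacencyX_tr exprD -!mulmxA.
have := congr1 (fun M : 'M_1 => M 0 0) E; rewrite !mxE /s => El.
transitivity (\sum_k ((w i)^T 0 k * w j k 0)).
  by apply: eq_bigr => u _; rewrite [_^T 0 u]mxE.
by rewrite El; apply: eq_bigr => u _; rewrite !mxE mul1r.
Qed.

Let wS k u : w k.+1 u 0 = \sum_v A u v * w k v 0.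
Proof. by rewrite /w exprS -[A * _]/(A *m _) -mulmxA mxE. Qed.

Let even_quad (x : 'I_n -> int) : (2 %| \sum_u \sum_v x u * A u v * x v)%Z.
Proof.
pose F u v := x u * A u v * x v.
have FC u v : F u v = F v u by rewrite /F !mxE edge_sym; ring.
rewrite (eq_bigr (fun u : 'I_n => \sum_(v : 'I_n | (v < u)%N) F u v
                         + \sum_(v : 'I_n | (u < v)%N) F u v)); last first.
  move=> u _; rewrite (bigID (fun v : 'I_n => (v < u)%N)) /=; congr (_ + _).
  rewrite (bigD1 u) ?ltnn //= {1}/F mxE edge_irr mulr0 mul0r add0r.
  by apply: eq_bigl => v; rewrite -leqNgt ltn_neqAle andbC eq_sym.
rewrite big_split /= [X in X + _](exchange_big_dep predT) //=.
under eq_bigr do under eq_bigr do rewrite FC.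
apply/dvdzP; exists (\sum_(i < n) \sum_(j < n | (i < j)%N) F i j); ring.
Qed.

Let s_even k : (2 %| s k.+1)%Z.
Proof.
have [m] := ubnP k; elim: m k => // m IH k lek.
case Dk: (odd k); last first.
  have -> : k.+1 = (k./2 + (k./2).+1)%N by lia.
  rewrite -wE; have := even_quad (fun u => w k./2 u 0).
  under eq_bigr do under eq_bigr do rewrite -mulrA.
  by under eq_bigr do rewrite -mulr_sumr -wS.
have -> : k.+1 = ((k./2).+1 + (k./2).+1)%N by lia.
have sj : (2 %| s (k./2).+1)%Z by apply: IH; lia.
have: (2 %| \sum_u w (k./2).+1 u 0 * w (k./2).+1 u 0 + s (k./2).+1)%Z.
  rewrite /s -big_split /=; apply: rpred_sum => u _.
  move: (w _ u 0) => x; apply/dvdzP.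
  have [q [r [-> r01]]] : exists q r : int, x = 2 * q + r /\ (r = 0 \/ r = 1).
    by exists (x %/ 2)%Z, (x %% 2)%Z; lia.
  case: r01 => ->; [exists (2 * q * q + q) | exists (2 * q * q + 3 * q + 1)]; ring.
by rewrite wE; lia.
Qed.

Lemma det_walk_matrix_dvd : (2 ^+ n./2 %| \det (walk_matrix G))%Z.
Proof.
have WW : (walk_matrix G)^T *m walk_matrix G = \matrix_(i, j) s (i + j).
  apply/matrixP=> i j; rewrite !mxE -wE; apply: eq_bigr => u _.
  by rewrite !mxE.
pose M' : 'M[int]_n := \matrix_(i, j) if i == 0 :> nat then s j else (s (i + j) %/ 2)%Z.
pose d : 'rV[int]_n := \row_i if i == 0 :> nat then 1 else 2.
have EM : \matrix_(i, j) s (i + j) = diag_mx d *m M'.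
  apply/matrixP=> i j; rewrite mul_diag_mx !mxE.
  case: eqP => [->|i0]; first by rewrite mul1r.
  by rewrite mulrC divzK // -(prednK (_ : 0 < i)%N) ?lt0n ?addSn //; apply/eqP.
have Ed : \det (diag_mx d) = 2 ^+ n.-1.
  rewrite det_diag (eq_bigr (fun i : 'I_n => if i == 0 :> nat then 1 else 2 : int)).
    case: (n) => [|n']; first by rewrite big_ord0.
    by rewrite big_ord_recl mul1r prodr_const card_ord.
  by move=> i _; rewrite mxE.
have D2 : \det (walk_matrix G) ^+ 2 = 2 ^+ n.-1 * \det M'.
  by rewrite -Ed -det_mulmx -EM -WW det_mulmx det_tr.
have [-> | W0] := eqVneq (\det (walk_matrix G)) 0; first exact: dvdz0.
have D2n : (2 ^ n.-1 %| `|\det (walk_matrix G)| ^ 2)%N.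
  by apply/dvdnP; exists `|\det M'|%N; rewrite -abszX D2 abszM abszX mulnC.
rewrite dvdzE abszX pfactor_dvdn ?absz_gt0 //.
move: D2n; rewrite pfactor_dvdn ?expn_gt0 ?absz_gt0 ?W0 // lognX.
by move: (logn _ _) => l; lia.
Qed.

End Facts.

(* Main.v *)
Require Import Defs.
From mathcomp Require Import all_boot all_order all_algebra all_field.
From mathcomp Require Import ring zify.

(** Let [H] be generalized cospectral with [G], with adjacency matrices [B] and
    [A]. The two spectra determine the numbers of walks of each length
    ([moment_determined]). If the walk-matrix of [G] is invertible, the linear
    map sending the walk vectors [B^k e] of [H] to those of [G] is therefore a
    rational orthogonal matrix [Q] with [Q^T A Q = B] and [Q e = e]
    ([krylov_intertwiner]). If [Q] is integral it is a permutation matrix, that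
    is an isomorphism; so one has to exclude every prime [p] from the
    denominator [l] of [Q]. Write [N = l Q], and suppose that [p] divides [l]
    but not all entries of [N].

    Modulo [p] the row and column spaces of [N] are stable under [B] and [A],
    isotropic, and orthogonal to [e]. An isotropic stable space counts twice in
    the characteristic polynomial [phi] ([degenerate_intertwiner]), with two
    consequences. First, [phi'(A)] kills the columns of [N] modulo [p]; as the
    quadratic form of [phi'(A)] takes values divisible by [l ^ 2] at these
    columns, [p ^ 2] divides [det phi'(A)], which is the discriminant up to
    sign. Second, a polynomial [m] of degree smaller than the number of
    vertices, not zero modulo [p], has [m(A) e] and [m(B) e] both divisible by
    [p]; pairing its coefficients with a column of [N] shows that [p ^ 2] divides
    the determinant of the walk-matrix. Both steps use [det_dvd_prime_sq]. For
    odd [p] this makes [p ^ 2] divide [d].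

    It remains to exclude 2. With at least two vertices the discriminant is even
    ([dvd2_discriminant]), so that an odd [d] forces [det W / 2 ^ (n./2)] to be
    odd; in particular [W] is invertible. Modulo 2 the walk vectors then span a
    space as large as its near-isotropy allows, and a column of [N] lies in it:
    it is [g(A) e] for a polynomial [g] of degree less than half the number of
    vertices. Divisibility by 4 of the forms of [A ^ k] at this column forces,
    by a Frobenius-type argument on [g ^ 2], the polynomial [g (X ^ 2)] to
    annihilate the halved Gram matrix of [W] modulo 2. But that matrix has
    odd determinant ([even_level_dvd2]). *)

Set Implicit Arguments.
Unset Strict Implicit.
Unset Printing Implicit Defensive.

Import Order.TTheory GRing.Theory Num.Theory.

Local Open Scope ring_scope.

(** * Invariant isotropic subspaces and characteristic polynomials *)

Lemma char_poly_tr (R : comNzRingType) n (A : 'M[R]_n) :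
  char_poly A^T = char_poly A.
Proof.
rewrite /char_poly -[RHS]det_tr; congr (\det _).
by rewrite /char_poly_mx linearB /= tr_scalar_mx map_trmx.
Qed.

Lemma char_poly_conj (R : comNzRingType) n (A B T X : 'M[R]_n) :
  X *m T = 1%:M -> T *m A = B *m T -> char_poly A = char_poly B.
Proof.
move=> XT TA; have TX := mulmx1C XT.
have -> : A = X *m B *m T by rewrite -mulmxA -TA mulmxA XT mul1mx.
rewrite /char_poly; have -> : char_poly_mx (X *m B *m T) =
    map_mx polyC X *m char_poly_mx B *m map_mx polyC T.
  rewrite /char_poly_mx !map_mxM mulmxBr mulmxBl scalar_mxC.
  rewrite -[Y in _ = Y - _]mulmxA -[map_mx _ X *m map_mx _ T]map_mxM XT.
  by rewrite map_mx1 mulmx1.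
by rewrite !det_mulmx mulrAC -det_mulmx -map_mxM XT map_mx1 det1 mul1r.
Qed.

Lemma char_poly_lblock (R : comNzRingType) r s (C : 'M[R]_r) (F : 'M[R]_(s, r))
    (D : 'M[R]_s) :
  char_poly (block_mx C 0 F D) = char_poly C * char_poly D.
Proof.
rewrite /char_poly -(det_lblock _ (- map_mx polyC F)); congr (\det _).
rewrite /char_poly_mx map_block_mx scalar_mx_block opp_block_mx add_block_mx.
by rewrite map_mx0 oppr0 addr0 add0r.
Qed.

(** A rectangular intertwiner of two matrices intertwines all polynomials in
    them; with one factor the restriction to an invariant subspace, this is how
    Cayley-Hamilton is transported below. *)
Lemma horner_mx_intertwine (R : comNzRingType) m n (A : 'M[R]_n.+1)
    (B : 'M[R]_m.+1) (T : 'M[R]_(m.+1, n.+1)) p :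
  T *m A = B *m T -> T *m horner_mx A p = horner_mx B p *m T.
Proof.
move=> TA; elim/poly_ind: p => [|p c IH].
  by rewrite !rmorph0 mulmx0 mul0mx.
rewrite !rmorphD !rmorphM /= !horner_mx_X !horner_mx_C mulmxDr mulmxDl.
rewrite -![_ * _]/(_ *m _) mulmxA IH -!mulmxA TA.
by rewrite scalar_mxC.
Qed.

Section Deflation.
Variable F : fieldType.

(** The rows of [K] span an [A]-stable space of row vectors on which [A] acts
    as [C]. Completing [K] to a basis makes [A] block triangular; [D] is the
    other diagonal block, and the columns of [X] are a basis of the kernel of
    [K], on which [A] acts as [D]. *)
Lemma invariant_complement r n (K : 'M[F]_(r, n)) (A : 'M_n) (C : 'M_r) :
    row_free K -> K *m A = C *m K ->
  exists s (D : 'M_s) (X : 'M_(n, s)) (Z : 'M_(s, n)),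
    [/\ Z *m X = 1%:M,
        forall t (E : 'M_(n, t)), K *m E = 0 -> E = X *m (Z *m E),
        A *m X = X *m D &
        char_poly A = char_poly C * char_poly D].
Proof.
move=> Kfree KA.
pose s := \rank K^C%MS; pose Z : 'M_(s, n) := row_base K^C%MS.
have Ens : n = (r + s)%N.
  by rewrite /s mxrank_compl (eqnP Kfree) subnKC // -(eqnP Kfree) rank_leq_col.
have Tfull : row_full (col_mx K Z).
  rewrite -sub1mx -addsmxE; apply: submx_trans (_ : (K + K^C <= _)%MS).
    by rewrite sub1mx addsmx_compl_full.
  by rewrite addsmxS ?eq_row_base.
have Tfree : row_free (col_mx K Z) by rewrite /row_free (eqnP Tfull) {1}Ens.
clearbody Z; move: s Z Ens Tfull Tfree => s Z Ens Tfull Tfree.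
have [Y YT] := row_fullP Tfull.
have TY : col_mx K Z *m Y = 1%:M.
  have [Y' TY'] := row_freeP Tfree.
  suff -> : Y = Y' by [].
  by rewrite -[Y]mulmx1 -TY' mulmxA YT mul1mx.
pose X1 := lsubmx Y; pose X := rsubmx Y.
have DY : Y = row_mx X1 X by rewrite hsubmxK.
move: TY YT; rewrite DY mul_col_row mul_row_col scalar_mx_block.
case/eq_block_mx=> KX1 KX ZX1 ZX YT.
have AX : A *m X = X *m (Z *m A *m X).
  rewrite -[LHS]mul1mx -YT mulmxDl -!mulmxA [K *m _]mulmxA KA -mulmxA KX.
  by rewrite !mulmx0 add0r.
exists s, (Z *m A *m X), X, Z; split=> // [t E KE|].
  by rewrite -[LHS]mul1mx -YT mulmxDl -!mulmxA KE mulmx0 add0r.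
rewrite -(char_poly_lblock _ (Z *m A *m X1)).
have TA : col_mx K Z *m A = block_mx C 0 (Z *m A *m X1) (Z *m A *m X) *m col_mx K Z.
  rewrite mul_block_col mul_col_mx KA mul0mx addr0; congr col_mx.
  by rewrite -!mulmxA -!mulmxDr YT !mulmx1.
rewrite -mul_row_col in YT.
move: (col_mx _ _) (row_mx _ _) (block_mx _ _ _ _) TA YT => T Y' B TA YT.
clear -TA YT Ens; move: T Y' B TA YT; rewrite -{}Ens => T Y' B TA YT.
exact: char_poly_conj YT TA.
Qed.

(** [D] restricted to the column space of [E] is [C]; transposing turns this
    space into a stable row space. *)
Lemma char_poly_dvd n t (D : 'M[F]_n) (E : 'M_(n, t)) (C : 'M_t) :
  row_free E^T -> D *m E = E *m C -> char_poly C %| char_poly D.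
Proof.
move=> Efree DE.
have /(invariant_complement Efree) : E^T *m D^T = C^T *m E^T.
  by rewrite -!trmx_mul DE.
case=> s [D' [X [Z [_ _ _]]]]; rewrite !char_poly_tr => ->.
exact: dvdp_mulr.
Qed.

Lemma horner_char_poly_intertwine r n (A : 'M[F]_n.+1) (C : 'M_r)
    (U : 'M_(n.+1, r)) :
  A *m U = U *m C -> horner_mx A (char_poly C) *m U = 0.
Proof.
case: r C U => [|r] C U AU; first by rewrite [U]thinmx0 mulmx0.
by rewrite -(horner_mx_intertwine _ (esym AU)) Cayley_Hamilton mulmx0.
Qed.

(** For a symmetric [A], an [A]-stable isotropic space counts twice in the
    characteristic polynomial: [A] acts as [C] on the space [U], dually to [C]
    on the quotient by the orthogonal of [U], and [U] lies in its orthogonal.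
    The cofactor [m] is the characteristic polynomial of [A] on the orthogonal
    of [U], so it kills every vector [e] there. *)
Lemma isotropic_deflation r n (A : 'M[F]_n.+1) (C : 'M_r) (U : 'M_(n.+1, r)) :
    A^T = A -> row_free U^T -> U^T *m U = 0 -> A *m U = U *m C ->
  exists m, [/\ char_poly A = char_poly C * m, char_poly C %| m &
    forall e : 'cV_n.+1, U^T *m e = 0 -> horner_mx A m *m e = 0].
Proof.
move=> Asym Ufree Uiso AU.
have UA : U^T *m A = C^T *m U^T by rewrite -{1}Asym -!trmx_mul AU.
have [s [D [X [Z [ZX XZ AX]]]]] := invariant_complement Ufree UA.
rewrite char_poly_tr => EA; exists (char_poly D); split=> //.
  have EU := XZ _ _ Uiso.
  apply: (@char_poly_dvd _ _ D (Z *m U)).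
    have [L UL] := row_freeP Ufree.
    apply/row_freeP; exists (X^T *m L).
    by rewrite mulmxA -trmx_mul -EU.
  rewrite -mulmxA -AU {2}EU [A *m _]mulmxA AX -[X *m D *m _]mulmxA.
  by rewrite [RHS]mulmxA ZX mul1mx.
by move=> e /XZ ->; rewrite [LHS]mulmxA horner_char_poly_intertwine ?mul0mx.
Qed.

(** Both the column space of [N] and its row space are isotropic, the first
    stable under [A] and the second under [B]. Factoring [N] through its rank
    identifies the two actions, hence their characteristic polynomial [chi],
    whose square divides that of [A]. So [chi] divides the derivative, which
    gives the first claim, and the common cofactor [m] gives the second. *)
Lemma degenerate_intertwiner n (A B N : 'M[F]_n.+1) :
    A^T = A -> B^T = B -> char_poly A = char_poly B -> A *m N = N *m B ->
    N^T *m N = 0 -> N *m N^T = 0 -> N != 0 ->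
  horner_mx A (char_poly A)^`() *m N = 0 /\
  exists m : {poly F}, [/\ m \is monic, (size m <= n.+1)%N,
    forall e : 'cV_n.+1, N^T *m e = 0 -> horner_mx A m *m e = 0 &
    forall e : 'cV_n.+1, N *m e = 0 -> horner_mx B m *m e = 0].
Proof.
move=> Asym Bsym chiAB AN NtN NNt N0.
have r_gt0 : (0 < \rank N)%N by rewrite lt0n mxrank_eq0.
have Ufree : row_free (col_base N)^T.
  by rewrite /row_free mxrank_tr; apply: col_base_full.
have Vfree := row_base_free N.
have EN := mulmx_base N.
move: (\rank N) (col_base N) (row_base N) r_gt0 Ufree Vfree EN => r U V r_gt0.
move=> Ufree Vfree EN.
have [V' VV'] := row_freeP Vfree; have [U' UU'] := row_freeP Ufree.
have U'U : U'^T *m U = 1%:M by rewrite -[U]trmxK -trmx_mul UU' trmx1.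
have NV' : N *m V' = U by rewrite -EN -mulmxA VV' mulmx1.
have U'N : U'^T *m N = V by rewrite -EN mulmxA U'U mul1mx.
pose C := V *m B *m V'.
have AU : A *m U = U *m C by rewrite -{1}NV' mulmxA AN -EN /C !mulmxA.
have VB : V *m B = C *m V.
  by rewrite -[LHS]mul1mx -U'U -mulmxA [U *m _]mulmxA EN -AN -EN
    [A *m _]mulmxA AU -!mulmxA [_ *m (U *m _)]mulmxA U'U mul1mx.
have Uiso : U^T *m U = 0.
  by rewrite -{1}NV' -NV' trmx_mul -mulmxA [N^T *m _]mulmxA NtN mul0mx mulmx0.
have Viso : V *m V^T = 0.
  by rewrite -U'N trmx_mul -mulmxA [N *m _]mulmxA NNt mul0mx mulmx0.
have [m [chiA Cm mA]] := isotropic_deflation Asym Ufree Uiso AU.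
have BV : B *m V^T = V^T *m C^T by rewrite -trmx_mul -VB trmx_mul Bsym.
have VTfree : row_free V^T^T by rewrite trmxK.
have VTiso : V^T^T *m V^T = 0 by rewrite trmxK.
have [m' []] := isotropic_deflation Bsym VTfree VTiso BV.
rewrite trmxK char_poly_tr -chiAB => chiB _ mB.
have C0 : char_poly C != 0 by rewrite monic_neq0 ?char_poly_monic.
have Em : m' = m by apply: (mulfI C0); rewrite -chiA chiB.
move: mB; rewrite {m' chiB}Em => mB.
split.
  have /dvdpP[q ->] : char_poly C %| (char_poly A)^`().
    by rewrite chiA derivM dvdp_add // ?dvdp_mulIl ?dvdp_mull.
  rewrite rmorphM -EN /= mulmxA -[_ * _]/(_ *m _) -[_ *m U]mulmxA.
  by rewrite horner_char_poly_intertwine // mulmx0 mul0mx.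
have m_monic : m \is monic.
  by have := char_poly_monic A; rewrite chiA monicMl ?char_poly_monic.
exists m; split=> // [|e Ne|e Ne].
- have := size_char_poly A; rewrite chiA size_monicM ?monic_neq0 ?char_poly_monic //.
  rewrite size_char_poly addSn /= => E.
  by rewrite -ltnS -E -[Y in (Y < _)%N]add0n ltn_add2r.
- by apply: mA; rewrite -NV' trmx_mul -mulmxA Ne mulmx0.
- by apply: mB; rewrite -U'N -mulmxA Ne mulmx0.
Qed.

End Deflation.

(** * Square divisors of determinants *)

(** The matrix determinant lemma, obtained by two eliminations in the bordered
    matrix [S]. *)
Lemma det_sub_rank1 (R : comNzRingType) n (M : 'M[R]_n) (u : 'cV[R]_n)
    (v : 'rV[R]_n) :
  GRing.rreg (\det M) -> \det (M - u *m v) = \det M - (v *m \adj M *m u) 0 0.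
Proof.
move=> M0; pose S : 'M_(1 + n) := block_mx 1%:M v u M.
have ES : \det S = \det (M - u *m v).
  have := det_mulmx S (block_mx 1%:M (- v) 0 1%:M).
  rewrite mulmx_block !mulmx1 !mul1mx !mulmx0 !addr0 addNr mulmxN.
  by rewrite det_lblock det_ublock !det1 !mul1r mulr1 addrC => ->.
have := det_mulmx S (block_mx (\det M)%:M 0 (- (\adj M *m u)) 1%:M).
rewrite mulmx_block !mulmx0 !mul1mx !mulmx1 !add0r !mulmxN.
have -> : M *m (\adj M *m u) = \det M *: u.
  by rewrite mulmxA mul_mx_adj mul_scalar_mx.
rewrite mul_mx_scalar subrr.
rewrite det_ublock det_lblock det_scalar1 det1 mulr1 ES => /M0 <-.
by rewrite -mulmxA det_mx11 !mxE eqxx mulr1n.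
Qed.

Lemma det_dvd_cross n (M : 'M[int]_n) i j (d : int) : d != 0 ->
    (forall a b, (d ^+ ((a == i) + (b == j)) %| M a b)%Z) ->
  (d ^+ 2 %| \det M)%Z.
Proof.
move=> d0 dM.
pose D (k : 'I_n) : 'rV[int]_n := \row_a d ^+ (a == k).
have detD k : \det (diag_mx (D k)) = d.
  rewrite det_diag (bigD1 k) //= big1 ?mulr1 ?mxE ?eqxx ?expr1 // => a.
  by rewrite mxE => /negPf ->; rewrite expr0.
pose M' := \matrix_(a, b) (M a b %/ d ^+ ((a == i) + (b == j)))%Z.
have -> : M = diag_mx (D i) *m M' *m diag_mx (D j).
  apply/matrixP => a b; rewrite mul_mx_diag mul_diag_mx !mxE.
  by rewrite mulrAC -exprD mulrC divzK.
rewrite !det_mulmx !detD mulrAC -expr2; exact: dvdz_mulr.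
Qed.

(** A left and a right null vector modulo [p] give one factor [p] only; a second
    one comes from the value of the bilinear form modulo [p ^ 2]. Installing
    [v] as row [i] and [x] as column [j], by base changes [P] and [R] of
    determinants [v 0 i] and [x j 0], makes row [i] and column [j] divisible by
    [p] and their crossing by [p ^ 2]. *)
Lemma det_dvd_prime_sq n (M : 'M[int]_n) (p : nat) (v : 'rV_n) (x : 'cV_n) i j :
    prime p -> ~~ (p %| v 0%R i)%Z -> ~~ (p %| x j 0%R)%Z ->
    (forall b, (p %| (v *m M)%R 0%R b)%Z) ->
    (forall a, (p %| (M *m x)%R a 0%R)%Z) ->
    (p%:Z ^+ 2 %| (v *m M *m x)%R 0%R 0%R)%Z ->
  (p%:Z ^+ 2 %| \det M)%Z.
Proof.
move=> p_pr vi xj vM Mx vMx.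
pose P : 'M[int]_n := 1%:M - delta_mx i 0 *m (delta_mx 0 i - v).
pose R : 'M[int]_n := 1%:M - (delta_mx j 0 - x) *m delta_mx 0 j.
have detP : \det P = v 0 i.
  rewrite det_sub_rank1 ?det1 //; last exact: rreg1.
  rewrite adj1 mulmx1 mulmxBl mul_delta_mx.
  by rewrite -colE !mxE !eqxx subKr.
have detR : \det R = x j 0.
  rewrite det_sub_rank1 ?det1 //; last exact: rreg1.
  rewrite adj1 mulmx1 mulmxBr mul_delta_mx.
  by rewrite -rowE !mxE !eqxx subKr.
have delta1 : delta_mx 0 0 = 1%:M :> 'M[int]_1.
  by apply/matrixP => a b; rewrite !ord1 !mxE.
have rowP a : row a P = if a == i then v else delta_mx 0 a.
  rewrite rowE mulmxBr mulmx1 mulmxA mul_delta_mx_cond.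
  case: eqP => [->|_]; rewrite ?mulr1n ?mulr0n ?mul0mx ?subr0 //.
  by rewrite delta1 mul1mx subKr.
have colR b : col b R = if b == j then x else delta_mx b 0.
  rewrite colE mulmxBl mul1mx -mulmxA mul_delta_mx_cond eq_sym.
  case: eqP => [->|_]; rewrite ?mulr1n ?mulr0n ?mulmx0 ?subr0 //.
  by rewrite delta1 mulmx1 subKr.
have PMR a b : (P *m M *m R) a b = (row a P *m M *m col b R) 0 0.
  rewrite -row_mul mxE [RHS]mxE; apply: eq_bigr => k _.
  by rewrite [row _ _ _ _]mxE [col _ _ _ _]mxE.
have : (p%:Z ^+ 2 %| \det (P *m M *m R))%Z.
  apply: (det_dvd_cross (i := i) (j := j)) => [|a b].
    by rewrite -lt0n prime_gt0.
  rewrite PMR rowP colR.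
  case: eqP => _; case: eqP => _; rewrite ?expr0 ?dvd1z ?expr1 //.
    by rewrite -colE mxE.
  by rewrite -mulmxA -rowE mxE.
have cop c : ~~ (p %| c)%Z -> coprimez (p%:Z ^+ 2) c.
  by move=> pc; rewrite coprimezE abszX coprimeXl // prime_coprime.
by rewrite !det_mulmx detP detR Gauss_dvdzl ?Gauss_dvdzr ?cop.
Qed.

(** * Integral intertwiners modulo a prime *)

Lemma trmx_horner (R : comNzRingType) n (A : 'M[R]_n.+1) p :
  (horner_mx A p)^T = horner_mx A^T p.
Proof.
elim/poly_ind: p => [|p c IH]; first by rewrite !rmorph0 trmx0.
rewrite !rmorphD !rmorphM /= !horner_mx_X !horner_mx_C linearD /= tr_scalar_mx.
by rewrite trmx_mul IH -(comm_horner_mx p (erefl : comm_mx A^T A^T)).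
Qed.

Lemma trmx_exp (R : comNzRingType) n (A : 'M[R]_n.+1) k :
  A^T = A -> (A ^+ k)^T = A ^+ k.
Proof.
by move=> Asym; have := trmx_horner A 'X^k;
  rewrite !rmorphXn /= !horner_mx_X Asym.
Qed.

Lemma col_mulmx (R : pzRingType) m n k (A : 'M[R]_(m, n)) (B : 'M_(n, k)) j :
  col j (A *m B) = A *m col j B.
Proof. by rewrite !colE mulmxA. Qed.

(** The walk-matrix of a graph is the case of the adjacency matrix and the
    all-ones vector. *)
Definition krylov (R : nzRingType) n (A : 'M[R]_n) (e : 'cV[R]_n) : 'M[R]_n :=
  \matrix_(u, k) (A ^+ k *m e) u 0.

Lemma horner_mx_krylov (R : comNzRingType) n (A : 'M[R]_n.+1) e (p : {poly R}) :
  (size p <= n.+1)%N -> horner_mx A p *m e = krylov A e *m \col_k p`_k.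
Proof.
move=> szp; have {1}-> : p = \poly_(k < n.+1) p`_k.
  apply/polyP => k; rewrite coef_poly; case: ltnP => // lenk.
  by rewrite nth_default ?(leq_trans szp).
rewrite poly_def linear_sum mulmx_suml; apply/colP => u.
rewrite summxE mxE; apply: eq_bigr => k _.
rewrite linearZ /= rmorphXn /= horner_mx_X -scalemxAl !mxE.
by rewrite mulrC; congr (_ * _); apply: eq_bigr => v _.
Qed.

Lemma map_krylov (R S : comNzRingType) (f : {rmorphism R -> S}) n
    (A : 'M[R]_n.+1) e :
  map_mx f (krylov A e) = krylov (map_mx f A) (map_mx f e).
Proof.
apply/matrixP => u k; rewrite [RHS]mxE -rmorphXn -map_mxM /= !mxE.
by congr (f _); apply: eq_bigr.
Qed.

Lemma mulmx_tr_scalar n (N : 'M[int]_n) (c : int) :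
  c != 0 -> N^T *m N = c%:M -> N *m N^T = c%:M.
Proof.
move=> c0 NtN; have N0 : \det N != 0.
  have := congr1 determinant NtN; rewrite det_mulmx det_tr det_scalar => E.
  by apply: contra_neq (expf_neq0 n c0) => N0; rewrite -E N0 mul0r.
have E : N *m N^T *m N = N *m c%:M by rewrite -mulmxA NtN.
have := congr1 (fun M => M *m \adj N) E.
rewrite /= scalar_mxC -!mulmxA mul_mx_adj mulmxA !mul_mx_scalar.
move=> Es; apply/matrixP => a b; apply: (mulfI N0).
by have := congr1 (fun M : 'M_n => M a b) Es; rewrite !mxE => ->; ring.
Qed.

(** For positive [l], the matrix [N] is [l] times a rational orthogonal matrix
    [Q] that satisfies [Q^T A Q = B] and fixes the all-ones vector. Keeping the
    denominator [l] apart avoids rational matrices. *)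
Definition intertwiner n (A B : 'M[int]_n) (l : nat) (N : 'M[int]_n) :=
  [/\ N^T *m N = (l ^ 2)%:R%:M, A *m N = N *m B &
      N *m const_mx 1 = (l%:R *: const_mx 1 : 'cV_n)].

Section Level.
Variables (n : nat) (A B N : 'M[int]_n.+1) (l : nat).
Hypotheses (Asym : A^T = A) (Bsym : B^T = B).
Hypotheses (l_gt0 : (0 < l)%N) (N_int : intertwiner A B l N).
Let e : 'cV[int]_n.+1 := const_mx 1.

Lemma intertwiner_mul_tr : N *m N^T = (l ^ 2)%:R%:M.
Proof.
have [NtN _ _] := N_int.
by apply: mulmx_tr_scalar NtN; rewrite pnatr_eq0 -lt0n expn_gt0 l_gt0.
Qed.

Lemma intertwiner_tr_ones : N^T *m e = l%:R *: e.
Proof.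
have [NtN _ Ne] := N_int.
have l0 : l%:R != 0 :> int by rewrite pnatr_eq0 -lt0n.
have := congr1 (mulmx N^T) Ne; rewrite mulmxA NtN mul_scalar_mx -scalemxAr.
move=> E; apply/matrixP => a b; apply: (mulfI l0).
have := congr1 (fun M : 'cV_n.+1 => M a b) E; rewrite !mxE => <-.
by rewrite natrX; ring.
Qed.

Lemma intertwiner_conj p :
  N^T *m horner_mx A p *m N = (l ^ 2)%:R *: horner_mx B p.
Proof.
have [NtN AN _] := N_int.
rewrite -mulmxA -(horner_mx_intertwine p (esym AN)) mulmxA NtN.
by rewrite mul_scalar_mx.
Qed.

Lemma intertwiner_krylov : (krylov A e)^T *m N = l%:R *: (krylov B e)^T.
Proof.
have [NtN AN _] := N_int.
have ANk k : N *m B ^+ k = A ^+ k *m N.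
  have := horner_mx_intertwine 'X^k (esym AN).
  by rewrite !rmorphXn /= !horner_mx_X.
apply/matrixP => k j.
have : (A ^+ k *m e)^T *m N = l%:R *: (B ^+ k *m e)^T.
  rewrite trmx_mul trmx_exp // -mulmxA -ANk mulmxA.
  rewrite -[N]trmxK -trmx_mul intertwiner_tr_ones linearZ /= -scalemxAl.
  by rewrite trmx_mul (trmx_exp _ Bsym).
move=> /(congr1 (fun M : 'rV_n.+1 => M 0 j)); rewrite !mxE => E.
transitivity (\sum_u (A ^+ k *m e)^T 0 u * N u j).
  by apply: eq_bigr => u _; rewrite !mxE.
by rewrite E; congr (_ * _); apply: eq_bigr.
Qed.

Variables (p : nat) (i j : 'I_n.+1).
Hypotheses (p_pr : prime p) (pl : (p %| l)%N) (Nij : ~~ (p %| N i j)%Z).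
Hypothesis chiAB : char_poly A = char_poly B.

Let f : {rmorphism int -> 'F_p} := intr.
Let pcharFp : p \in [pchar 'F_p]. Proof. exact: pchar_Fp. Qed.

Let f_eq0 x : (p %| x)%Z = (f x == 0).
Proof. exact: dvdz_pcharf. Qed.

(** [N^T N] is divisible by [l ^ 2], so modulo a prime divisor of [l] the matrix
    [N] has isotropic row and column spaces, and both are orthogonal to the
    all-ones vector since [N] scales it by [l]. *)
Lemma degenerate_mod_p :
  (forall a b, (p %| (horner_mx A (char_poly A)^`() *m N)%R a b)%Z) /\
  exists m : {poly int}, [/\ (size m <= n.+1)%N,
    exists k : 'I_n.+1, ~~ (p %| m`_k)%Z,
    forall a, (p %| (krylov A e *m \col_k m`_k)%R a 0%R)%Z &
    forall a, (p %| (krylov B e *m \col_k m`_k)%R a 0%R)%Z].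
Proof.
have [NtN AN Ne] := N_int.
have fl : f l%:R = 0 by apply/eqP; rewrite -f_eq0 natz.
have fl2 : f (l ^ 2)%:R = 0 by rewrite natrX rmorphXn /= fl expr0n.
pose fA := map_mx f A; pose fB := map_mx f B; pose fN := map_mx f N.
have [|||||||dA [m [m_mon szm mA mB]]] := @degenerate_intertwiner _ n fA fB fN.
- by rewrite /fA map_trmx Asym.
- by rewrite /fB map_trmx Bsym.
- by rewrite -!map_char_poly chiAB.
- by rewrite -!map_mxM AN.
- by rewrite map_trmx -map_mxM NtN map_scalar_mx fl2 raddf0.
- by rewrite map_trmx -map_mxM intertwiner_mul_tr map_scalar_mx fl2 raddf0.
- apply: contra Nij => /eqP/matrixP/(_ i j); rewrite !mxE => /eqP.
  by rewrite f_eq0.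
split=> [a b|].
  rewrite f_eq0; have := congr1 (fun M : 'M_n.+1 => M a b) dA.
  rewrite -map_char_poly deriv_map -map_horner_mx -map_mxM.
  by rewrite [LHS]mxE [RHS]mxE => ->.
pose M := \poly_(k < n.+1) (nat_of_ord m`_k)%:Z.
have fM : map_poly f M = m.
  apply/polyP => k; rewrite coef_map coef_poly; case: ltnP => lenk.
    by rewrite /= -pmulrn natr_Zp.
  by rewrite raddf0 nth_default ?(leq_trans szm).
have szM : (size M <= n.+1)%N by apply: size_poly.
have kill C : horner_mx (map_mx f C) m *m map_mx f e = 0 ->
    forall a, (p %| (krylov C e *m \col_k M`_k)%R a 0%R)%Z.
  move=> mC a; rewrite -horner_mx_krylov // f_eq0.
  have := congr1 (fun V : 'cV_n.+1 => V a 0) mC.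
  by rewrite -fM -map_horner_mx -map_mxM [LHS]mxE [RHS]mxE => ->.
exists M; split=> //.
- have szm' : ((size m).-1 < n.+1)%N.
    by rewrite prednK // lt0n size_poly_eq0 monic_neq0.
  exists (Ordinal szm'); rewrite f_eq0 -coef_map fM /=.
  by rewrite -[_`__]/(lead_coef m) (monicP m_mon) oner_eq0.
- by apply/kill/mA; rewrite map_trmx -map_mxM intertwiner_tr_ones map_mxZ fl scale0r.
- by apply/kill/mB; rewrite -map_mxM Ne map_mxZ fl scale0r.
Qed.

Let pl2 (c : int) : (p%:Z ^+ 2 %| (l ^ 2)%:R * c)%Z.
Proof. by rewrite natrX natz dvdz_mulr // dvdz_exp2r. Qed.

(** A column of [N] is a null vector modulo [p] on both sides, and the quadratic
    form of a polynomial in [A] takes a value divisible by [l ^ 2] at it. *)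
Lemma prime_sq_dvd_det_deriv :
  (p%:Z ^+ 2 %| \det (horner_mx A (char_poly A)^`()))%Z.
Proof.
have [dA _] := degenerate_mod_p.
have HM : (horner_mx A (char_poly A)^`())^T = horner_mx A (char_poly A)^`().
  by rewrite trmx_horner Asym.
have colE' a : (horner_mx A (char_poly A)^`() *m col j N) a 0 =
    (horner_mx A (char_poly A)^`() *m N) a j.
  by rewrite -col_mulmx mxE.
apply: (@det_dvd_prime_sq _ _ p (col j N)^T (col j N) i i) => //.
- by rewrite !mxE.
- by rewrite mxE.
- move=> b; rewrite -HM -trmx_mul mxE colE'; exact: dA.
- by move=> a; rewrite colE'.
- rewrite tr_col -row_mul -col_mulmx -row_mul.
  by rewrite mxE mxE intertwiner_conj mxE.
Qed.

(** The coefficients of the common annihilator [m] of the all-ones vector give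
    the second null vector. The pairing is [l] times an entry of the Krylov
    matrix of [B] applied to [m], and each of these factors supplies one [p]. *)
Lemma prime_sq_dvd_det_krylov : (p%:Z ^+ 2 %| \det (krylov A e))%Z.
Proof.
have [_ [m [szm [k mk] mA mB]]] := degenerate_mod_p.
rewrite -det_tr.
have mAt C b : ((\col_k m`_k)^T *m (krylov C e)^T) 0 b =
    (krylov C e *m \col_k m`_k) b 0.
  by rewrite -trmx_mul mxE.
apply: (@det_dvd_prime_sq _ _ p (\col_k m`_k)^T (col j N) k i) => //.
- by rewrite !mxE.
- by rewrite mxE.
- by move=> b; rewrite mAt.
- move=> a; rewrite -col_mulmx intertwiner_krylov mxE mxE natz.
  exact: dvdz_mulr.
- rewrite -mulmxA -col_mulmx intertwiner_krylov -col_mulmx -scalemxAr.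
  by rewrite mxE mxE mAt natz expr2 dvdz_mul.
Qed.

End Level.

(** * Krylov vectors and walk counts modulo 2 *)

(** The first [r + 1] Krylov vectors lie in a space of dimension [r]. *)
Lemma krylov_annihilator (F : fieldType) n (A : 'M[F]_n.+1) e :
  exists2 p : {poly F}, p != 0 &
    (size p <= (\rank (krylov A e)).+1)%N /\ horner_mx A p *m e = 0.
Proof.
set r := \rank _.
have powE k : exists c : 'cV_n.+1, A ^+ k *m e = krylov A e *m c.
  have chi0 : char_poly A != 0 by rewrite monic_neq0 ?char_poly_monic.
  pose q := 'X^k %% char_poly A; exists (\col_i q`_i).
  rewrite -horner_mx_krylov; last first.
    by rewrite -ltnS -(size_char_poly A) ltn_modp.
  have := congr1 (horner_mx A) (divp_eq 'X^k (char_poly A)).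
  rewrite rmorphD rmorphM /= Cayley_Hamilton mulr0 add0r.
  by rewrite rmorphXn /= horner_mx_X => ->.
pose K : 'M_(r.+1, n.+1) := \matrix_(k, u) (A ^+ k *m e) u 0.
have rowK k : row k K = (A ^+ k *m e)^T.
  by apply/rowP => u; rewrite !mxE.
have Kdep : ~~ row_free K.
  rewrite -row_leq_rank -ltnNge ltnS /r -[X in (_ <= X)%N]mxrank_tr mxrankS //.
  apply/row_subP => k; rewrite rowK; have [c ->] := powE k.
  by rewrite trmx_mul submxMl.
have c0 : nz_row (kermx K) != 0 by rewrite nz_row_eq0 kermx_eq0.
have /sub_kermxP cK := nz_row_sub (kermx K).
move: (nz_row _) c0 cK => c c0 cK.
pose p := \poly_(k < r.+1) (if insub k is Some i then c 0 i else 0).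
have pE (k : 'I_r.+1) : p`_k = c 0 k by rewrite coef_poly ltn_ord valK.
exists p; last split.
- by apply: contra_neq c0 => p0; apply/rowP => k; rewrite -pE p0 coef0 mxE.
- exact: size_poly.
have := congr1 trmx cK; rewrite trmx0 mulmx_sum_row linear_sum => <-.
rewrite /p poly_def linear_sum mulmx_suml.
apply: eq_bigr => k _; rewrite valK linearZ /= rmorphXn /= horner_mx_X.
by rewrite -scalemxAl linearZ /= rowK trmxK.
Qed.

Lemma sum_symmetric n (F : 'I_n -> 'I_n -> int) :
    (forall u v, F u v = F v u) ->
  \sum_u \sum_v F u v =
    \sum_u F u u + 2 * \sum_(u < n) \sum_(v < n | (v < u)%N) F u v.
Proof.
move=> FC; have splitF u : \sum_v F u v =
    F u u + \sum_(v < n | (v < u)%N) F u v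
          + \sum_(v < n | (u < v)%N) F u v.
  rewrite (bigD1 u) //= -addrA; congr (_ + _).
  rewrite (bigID (fun v : 'I_n => (v < u)%N)) /=; congr (_ + _).
    by apply: eq_bigl => v; rewrite andbC -val_eqE /= ltn_neqAle; case: ltngtP.
  by apply: eq_bigl => v; rewrite -val_eqE /=; case: ltngtP.
under eq_bigr do rewrite splitF.
rewrite !big_split /= -addrA mulr_natl mulr2n; congr (_ + (_ + _)).
rewrite (exchange_big_dep predT) //=.
by apply: eq_bigr => u _; apply: eq_bigr => v _.
Qed.

Lemma dvd2_sqr_sub (x : int) : (2 %| x * x - x)%Z.
Proof.
have [q [r [-> r01]]] : exists q r : int, x = 2 * q + r /\ (r = 0 \/ r = 1).
  by exists (x %/ 2)%Z, (x %% 2)%Z; lia.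
apply/dvdzP; case: r01 => ->.
  by exists (2 * q * q - q); ring.
by exists (2 * q * q + q); ring.
Qed.

(** For an adjacency matrix, the number of walks with [k] steps. *)
Definition moment n (A : 'M[int]_n) k : int :=
  ((const_mx 1 : 'cV[int]_n)^T *m A ^+ k *m (const_mx 1 : 'cV[int]_n)) 0 0.

Section Moments.
Variables (n : nat) (A : 'M[int]_n.+1).
Hypothesis Asym : A^T = A.
Let e : 'cV[int]_n.+1 := const_mx 1.

Lemma momentE k : moment A k = \sum_u (A ^+ k *m e) u 0.
Proof.
rewrite /moment -mulmxA mxE; apply: eq_bigr => u _.
by rewrite [_^T _ _]mxE [const_mx _ _ _]mxE mul1r.
Qed.

Lemma moment_sum k : moment A k = \sum_u \sum_v (A ^+ k) u v.
Proof.
rewrite momentE; apply: eq_bigr => u _; rewrite mxE.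
by apply: eq_bigr => v _; rewrite !mxE mulr1.
Qed.

Lemma krylov_gram : (krylov A e)^T *m krylov A e = \matrix_(i, j) moment A (i + j).
Proof.
apply/matrixP => i j; rewrite mxE [RHS]mxE.
have -> : moment A (i + j) = ((A ^+ i *m e)^T *m (A ^+ j *m e)) 0 0.
  by rewrite trmx_mul (trmx_exp _ Asym) /moment exprD -!mulmxA.
by rewrite mxE; apply: eq_bigr => u _; rewrite !mxE.
Qed.

Hypothesis Adiag : forall u, A u u = 0.

Lemma dvd2_quadratic_form (x : 'cV_n.+1) : (2 %| (x^T *m A *m x)%R 0%R 0%R)%Z.
Proof.
have -> : (x^T *m A *m x) 0 0 = \sum_u \sum_v x u 0 * A u v * x v 0.
  rewrite -mulmxA mxE; apply: eq_bigr => u _.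
  rewrite [_^T _ _]mxE [(A *m x) _ _]mxE mulr_sumr.
  by apply: eq_bigr => v _; rewrite mulrA.
rewrite sum_symmetric => [|u v]; last by rewrite -{1}Asym [A^T _ _]mxE; ring.
rewrite big1 ?add0r ?dvdz_mulr // => u _.
by rewrite Adiag mulr0 mul0r.
Qed.

(** An odd power of [A] is a quadratic form of [A] at an integer vector, which
    is even as [A] has zero diagonal. For an even power the count is a sum of
    squares, congruent to the sum itself, that is to the count for half the
    length. *)
Lemma dvd2_moment k : (2 %| moment A k.+1)%Z.
Proof.
have [m] := ubnP k; elim: m k => // m IH k lek.
case Dk: (odd k); last first.
  have -> : k.+1 = (k./2 + 1 + k./2)%N by lia.
  rewrite /moment !exprD expr1 -[X in X *m _ *m _]/(e^T).
  rewrite -[A ^+ _ * A * _]/(A ^+ k./2 *m A *m A ^+ k./2).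
  have := dvd2_quadratic_form (A ^+ k./2 *m e).
  by rewrite trmx_mul (trmx_exp _ Asym) -!mulmxA.
have -> : k.+1 = ((k./2).+1 + (k./2).+1)%N by lia.
have sj : (2 %| moment A (k./2).+1)%Z by apply: IH; lia.
have -> : moment A ((k./2).+1 + (k./2).+1) =
    \sum_u ((A ^+ (k./2).+1 *m e) u 0 * (A ^+ (k./2).+1 *m e) u 0).
  rewrite /moment exprD -[A ^+ _ * _]/(_ *m _) mulmxA -mulmxA mxE.
  apply: eq_bigr => u _; congr (_ * _).
  by rewrite -{1}(trmx_exp (k./2).+1 Asym) -trmx_mul mxE.
rewrite -(rpredBr _ sj) momentE -sumrB.
by apply: rpred_sum => u _; apply: dvd2_sqr_sub.
Qed.

(** The trace of an even power is the sum of the squared entries of the half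
    power, congruent modulo 2 to the sum of these entries. *)
Lemma dvd2_trace k : (2 %| \tr (A ^+ k.+1))%Z.
Proof.
case Dk: (odd k); last first.
  have -> : k.+1 = (k./2 + 1 + k./2)%N by lia.
  apply: rpred_sum => i _; have := dvd2_quadratic_form (col i (A ^+ k./2)).
  rewrite tr_col (trmx_exp _ Asym) -row_mul -col_mulmx -row_mul !exprD expr1.
  by rewrite [col _ _ _ _]mxE [row _ _ _ _]mxE.
have -> : k.+1 = ((k./2).+1 + (k./2).+1)%N by lia.
have sj := dvd2_moment k./2.
rewrite -(rpredBr _ sj) moment_sum -sumrB.
apply: rpred_sum => u _; rewrite exprD mxE -sumrB; apply: rpred_sum => v _.
by rewrite -{2}(trmx_exp _ Asym) [(_^T) _ _]mxE dvd2_sqr_sub.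
Qed.
End Moments.

(** * Intertwiners modulo 2 *)

(** Spreading coefficients over the even places is the passage from [g] to
    [g (X ^ 2)]. *)
Lemma sum_even_index (F : nat -> int) n :
  \sum_(m < n) (if odd m then 0 else F m./2) = \sum_(i < uphalf n) F i.
Proof.
elim: n => [|n IH]; first by rewrite !big_ord0.
rewrite big_ord_recr /= IH; case En: (odd n).
  by rewrite addr0 uphalf_half En.
by rewrite uphalf_half En add0n big_ord_recr.
Qed.

Section GramMod2.
Variables (n : nat) (A : 'M[int]_n.+1).
Hypotheses (Asym : A^T = A) (Adiag : forall u, A u u = 0).
Let e : 'cV[int]_n.+1 := const_mx 1.
Let W := krylov A e.

(** The diagonal of 2-powers that can be divided out of the Gram matrix of the
    Krylov vectors. All moments of positive order are even; the moment of order
    zero is the number of vertices, so the first row keeps its factor 2 only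
    when this number is even. *)
Definition gram_scale : 'rV[int]_n.+1 :=
  \row_i (if (i == 0 :> nat) && odd n.+1 then 1 else 2).

Definition half_gram : 'M[int]_n.+1 :=
  \matrix_(i, j) (moment A (i + j) %/ gram_scale 0%R i)%Z.

Lemma gram_scale_half_gram : W^T *m W = diag_mx gram_scale *m half_gram.
Proof.
rewrite krylov_gram //; apply/matrixP => i j; rewrite mul_diag_mx !mxE.
rewrite mulrC divzK //; case: ifP => [//|]; case: i => [[|i] lti] /= En.
  case: j => [[|j] ltj] /=; last exact: dvd2_moment.
  rewrite /moment expr0 mulmx1 mxE (eq_bigr (fun=> 1)) => [|u _]; last first.
    by rewrite !mxE.
  by rewrite sumr_const card_ord; lia.
exact: dvd2_moment.
Qed.

Lemma det_gram_scale : \det (diag_mx gram_scale) = (2 ^+ n.+1./2) ^+ 2.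
Proof.
rewrite det_diag big_ord_recl !mxE eqxx.
rewrite (eq_bigr (fun=> 2)) => [|i _]; last by rewrite mxE.
rewrite prodr_const card_ord -exprM muln2.
case: ifP => /= En; last by rewrite -exprS; congr (_ ^+ _); lia.
by rewrite mul1r; congr (_ ^+ _); lia.
Qed.

Lemma gram_scale_dvd4 (x : int) i :
  (4 %| gram_scale 0%R i * x)%Z -> (2 %| x)%Z.
Proof. by rewrite mxE; case: ifP => _; lia. Qed.

Lemma gram_scale_dvd2 i : (gram_scale 0%R i %| 2)%Z.
Proof. by rewrite mxE; case: ifP. Qed.

Let f : {rmorphism int -> 'F_2} := intr.
Let f_eq0 x : (2 %| x)%Z = (f x == 0).
Proof. exact: dvdz_pcharf (pchar_Fp (isT : prime 2)) x. Qed.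

(** Modulo 2 the Gram matrix vanishes except perhaps for its corner, so the
    Krylov space is nearly isotropic. *)
Lemma rank_krylov_mod2 : (\rank (map_mx f W) <= uphalf n.+1)%N.
Proof.
set r := \rank _.
have gram0 : (\rank ((map_mx f W)^T *m map_mx f W) <= odd n.+1)%N.
  rewrite map_trmx -map_mxM /W krylov_gram //.
  have -> : map_mx f (\matrix_(i < n.+1, j < n.+1) moment A (i + j)) =
      (n.+1)%:R *: (delta_mx 0 0 : 'M['F_2]_n.+1).
    apply/matrixP => i j; rewrite !mxE.
    have [/eqP|] := eqVneq (i + j)%N 0%N.
      rewrite addn_eq0 => /andP[/eqP i0 /eqP j0].
      rewrite -!val_eqE /= i0 j0 /= mulr1.
      rewrite /moment expr0 mulmx1 mxE (eq_bigr (fun=> 1)) => [|u _].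
        by rewrite sumr_const card_ord rmorph_nat.
      by rewrite !mxE.
    case Ek: (i + j)%N => [//|k] _.
    rewrite (_ : f _ = 0); last by apply/eqP; rewrite -f_eq0 dvd2_moment.
    rewrite -!val_eqE /=; move: Ek.
    by case: (nat_of_ord i) => [|?]; case: (nat_of_ord j) => [|?]; rewrite ?mulr0.
  case En: (odd n.+1); last first.
    have -> : (n.+1)%:R = 0 :> 'F_2.
      by apply/eqP; rewrite -(rmorph_nat f) -f_eq0; lia.
    by rewrite scale0r mxrank0.
  by rewrite (leq_trans (mxrank_scale _ _)) ?mxrank_delta.
have := mxrank_Frobenius (map_mx f W)^T 1%:M (map_mx f W).
rewrite mulmx1 mul1mx mxrank1 mxrank_tr -/r.
move/leq_trans/(_ (leq_add (leqnn _) gram0)); lia.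
Qed.

Variables (B N : 'M[int]_n.+1) (l : nat).
Hypotheses (Bsym : B^T = B) (l_gt0 : (0 < l)%N).
Hypotheses (N_int : intertwiner A B l N) (l_even : (2 %| l)%N).
Variable q : int.
Hypotheses (detW : \det W = 2 ^+ n.+1./2 * q) (q_odd : ~~ (2 %| q)%Z).

Let delta := \det half_gram.

Lemma det_half_gram : delta = q ^+ 2.
Proof.
have := congr1 determinant gram_scale_half_gram.
rewrite !det_mulmx det_tr det_gram_scale detW -expr2 exprMn.
have h0 : (2 ^+ n.+1./2) ^+ 2 != 0 :> int by rewrite !expf_neq0.
by move/(mulfI h0); rewrite /delta => <-.
Qed.

Let f_delta : f delta = 1.
Proof.
have : f delta != 0.
  by rewrite det_half_gram rmorphXn expf_neq0 //= -f_eq0.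
by case: (f delta) => [[|[|//]] lt] //= _; apply: val_inj.
Qed.

Let detW0 : \det W != 0.
Proof.
by rewrite detW mulf_neq0 ?expf_neq0 //; apply: contraNneq q_odd => ->.
Qed.

(** The column is orthogonal to the Krylov space modulo 2, and this space is its
    own orthogonal up to the parity of the dimension. Since [half_gram] is
    invertible modulo 2, its adjugate gives explicit coordinates: the column
    times the odd number [delta] is an integral combination of Krylov
    vectors. *)
Lemma column_in_krylov j : exists z, map_mx f (col j N) = map_mx f W *m z.
Proof.
pose v := col j N.
have Wv k : (2 %| (W^T *m v)%R k 0%R)%Z.
  rewrite -col_mulmx (intertwiner_krylov Asym Bsym l_gt0 N_int) mxE mxE (natz l).
  exact: dvdz_mulr.
pose y := \col_k ((W^T *m v)%R k 0%R %/ gram_scale 0%R k)%Z.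
have Ey : W^T *m v = diag_mx gram_scale *m y.
  apply/colP => k; rewrite mul_diag_mx [RHS]mxE [y _ _]mxE mulrC divzK //.
  exact: dvdz_trans (gram_scale_dvd2 k) (Wv k).
(* [W^T] is injective, so this identifies [delta *: v] exactly, not only
   modulo 2. *)
have : W^T *m (delta *: v - W *m (\adj half_gram *m y)) = 0.
  rewrite mulmxBr -scalemxAr Ey mulmxA gram_scale_half_gram -!mulmxA.
  by rewrite [half_gram *m _]mulmxA mul_mx_adj mul_scalar_mx -scalemxAr subrr.
move=> /(congr1 (mulmx (\adj W^T))); rewrite mulmxA mul_adj_mx det_tr mulmx0.
rewrite mul_scalar_mx => Ez.
have : delta *: v = W *m (\adj half_gram *m y).
  apply/colP => k; apply: (mulfI detW0); apply/eqP; rewrite -subr_eq0 -mulrBr.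
  have := congr1 (fun M : 'cV_n.+1 => M k 0) Ez.
  by rewrite [LHS]mxE [X in _ * X]mxE [X in _ + X]mxE [RHS]mxE => ->.
move/(congr1 (map_mx f)); rewrite map_mxZ f_delta scale1r map_mxM => Ev.
by exists (map_mx f (\adj half_gram *m y)).
Qed.

(** Modulo 4 the cross terms of the double sum disappear, since each comes twice
    with an even moment; what is left is the image of the vector [w], with the
    [u i] at the even places [2 i], under the Gram matrix. As [half_gram] is
    invertible modulo 2, [w] is even. *)
Lemma even_squares_vanish (u : nat -> int) :
    (forall i, u i * u i = u i) ->
    (forall k, (4 %| \sum_(i < uphalf n.+1) \sum_(j < uphalf n.+1)
                  u i * u j * moment A (i + j + k))%Z) ->
  forall i, (i < uphalf n.+1)%N -> (2 %| u i)%Z.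
Proof.
move=> uu sum4 i lti.
have sum4' k : (4 %| \sum_(i < uphalf n.+1) u i * moment A (i + i + k))%Z.
  have := sum4 k.
  rewrite (sum_symmetric (F := fun i j : 'I__ => u i * u j * moment A (i + j + k)));
    last first.
    by move=> a b; rewrite addnC (mulrC (u a)); congr (_ * moment A _); lia.
  rewrite (eq_bigr (fun i : 'I__ => u i * moment A (i + i + k))); last first.
    by move=> a _; rewrite uu.
  have drop (x y : int) : (2 %| y)%Z -> (4 %| x + 2 * y)%Z -> (4 %| x)%Z by lia.
  apply: drop.
  apply: rpred_sum => a _; apply: rpred_sum => b lba.
  by rewrite dvdz_mull // -(prednK (_ : 0 < a + b + k)%N) ?dvd2_moment //; lia.
pose w : 'cV[int]_n.+1 := \col_m (if odd m then 0 else u m./2).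
have Mw k : (2 %| (half_gram *m w)%R k 0%R)%Z.
  apply: (gram_scale_dvd4 (i := k)).
  have -> : gram_scale 0 k * (half_gram *m w) k 0 =
      (diag_mx gram_scale *m half_gram *m w) k 0.
    by rewrite -mulmxA mul_diag_mx mxE.
  rewrite -gram_scale_half_gram krylov_gram // mxE.
  pose F i := u i * moment A (i + i + k).
  rewrite (eq_bigr (fun m : 'I_n.+1 => if odd m then 0 else F m./2)); last first.
    move=> m _; rewrite !mxE; case: ifP => Em; first by rewrite mulr0.
    by rewrite mulrC /F; congr (_ * moment A _); lia.
  by rewrite (sum_even_index F); exact: sum4'.
have lti2 : (i.*2 < n.+1)%N by move: lti; lia.
have : (2 %| delta * u i)%Z.
  have -> : delta * u i = (\adj half_gram *m (half_gram *m w)) (Ordinal lti2) 0.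
    by rewrite mulmxA mul_adj_mx mul_scalar_mx !mxE odd_double doubleK.
  rewrite mxE; apply: rpred_sum => k _; exact: dvdz_mull.
by rewrite !f_eq0 rmorphM /= f_delta mul1r.
Qed.

(** Modulo 2 a column of [N] is a polynomial [g] of small degree in [A] applied
    to the all-ones vector. Its integral lift [G] differs from the column by an
    even vector, so the forms of the powers of [A] at [G] are divisible by 4,
    as they are at the column. Then all coefficients of [g] vanish. *)
Lemma even_level_dvd2 i j : (2 %| N i j)%Z.
Proof.
have [z Ev] := column_in_krylov j.
pose fA := map_mx f A; pose fe : 'cV_n.+1 := map_mx f e.
have fW : map_mx f W = krylov fA fe by rewrite map_krylov.
pose h := uphalf n.+1.
have [g [szg Eg]] : exists g : {poly 'F_2}, (size g <= h)%N /\
    map_mx f (col j N) = horner_mx fA g *m fe.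
  have [p p0 [szp pe]] := krylov_annihilator fA fe.
  (* Reducing by an annihilator of [e] bounds the degree by the rank. *)
  pose Z := \poly_(k < n.+1) (if insub k is Some i then z i 0 else 0).
  have EZ : map_mx f (col j N) = horner_mx fA Z *m fe.
    rewrite horner_mx_krylov ?size_poly // Ev fW; congr (_ *m _).
    by apply/colP => k; rewrite mxE coef_poly ltn_ord valK.
  exists (Z %% p); split.
    have : (size (Z %% p)%R < size p)%N by rewrite ltn_modp.
    move=> lt; rewrite -ltnS (leq_trans lt) // (leq_trans szp) // ltnS -fW.
    exact: rank_krylov_mod2.
  rewrite EZ {1}(divp_eq Z p) rmorphD rmorphM mulmxDl /=.
  by rewrite -[_ * _]/(_ *m _) -mulmxA pe mulmx0 add0r.
pose u k : int := (nat_of_ord g`_k)%:Z.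
have fu k : f (u k) = g`_k by rewrite /= -pmulrn natr_Zp.
(* The lift has values in {0, 1}, so squaring its values changes nothing. *)
have uu k : u k * u k = u k by rewrite /u; case: (g`_k) => [[|[|//]] lt].
pose U := \poly_(k < h) u k.
have fU : map_poly f U = g.
  apply/polyP => k; rewrite coef_map coef_poly; case: ltnP => [_|lenk].
    exact: fu.
  by rewrite raddf0 nth_default ?(leq_trans szg).
pose G := horner_mx A U *m e.
have fG : map_mx f G = map_mx f (col j N).
  by rewrite Eg map_mxM map_horner_mx fU.
have EG : G = \sum_(i < h) u i *: (A ^+ i *m e).
  rewrite /G /U poly_def linear_sum mulmx_suml; apply: eq_bigr => k _.
  by rewrite linearZ /= rmorphXn /= horner_mx_X scalemxAl.
have EGt : G^T = \sum_(i < h) u i *: (A ^+ i *m e)^T.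
  by rewrite EG linear_sum; apply: eq_bigr => k _; rewrite linearZ.
clearbody G.
have [b Eb] : exists b, col j N = G + 2 *: b.
  pose b := \col_i ((col j N - G)%R i 0%R %/ 2)%Z.
  exists b; apply/colP => k.
  rewrite [RHS]mxE [X in _ + X]mxE [b _ _]mxE mulrC divzK.
    by rewrite !mxE addrC subrK.
  rewrite f_eq0 !mxE rmorphB /= subr_eq0.
  by have := congr1 (fun M : 'cV_n.+1 => M k 0) fG; rewrite !mxE => ->.
have quad4 k : (4 %| (G^T *m A ^+ k *m G)%R 0%R 0%R)%Z.
  have : (4 %| ((col j N)^T *m A ^+ k *m col j N)%R 0%R 0%R)%Z.
    rewrite tr_col -row_mul -col_mulmx -row_mul mxE mxE.
    have := intertwiner_conj N_int 'X^k.
    rewrite !rmorphXn /= !horner_mx_X => ->; rewrite mxE natrX.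
    have /dvdnP[c ->] := l_even.
    rewrite natrM; move: ((B ^+ k) j j) => x.
    by rewrite (_ : _ * x = 4 * (c%:R ^+ 2 * x)) ?dvdz_mulr //; ring.
  have bGC : b^T *m A ^+ k *m G = (G^T *m A ^+ k *m b)^T.
    by rewrite !trmx_mul trmxK trmx_exp // mulmxA.
  have -> : (col j N)^T = G^T + 2 *: b^T.
    by rewrite Eb; apply/rowP => a; rewrite !mxE.
  rewrite Eb !mulmxDl !mulmxDr -!scalemxAl -!scalemxAr bGC.
  move: (G^T *m _ *m G) (G^T *m _ *m b) (b^T *m _ *m b) => X Y V.
  by rewrite !mxE; move: (X _ _) (Y _ _) (V _ _) => x y w; lia.
have u_even : forall k, (k < h)%N -> (2 %| u k)%Z.
  apply: even_squares_vanish => // k.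
  suff -> : \sum_(i < h) \sum_(j < h) u i * u j * moment A (i + j + k) =
    (G^T *m A ^+ k *m G) 0 0 by [].
  rewrite EGt EG !mulmx_suml summxE; apply: eq_bigr => a _.
  rewrite mulmx_sumr summxE; apply: eq_bigr => c _.
  rewrite -!scalemxAl -scalemxAr !scalerA [RHS]mxE.
  congr (_ * _); rewrite addnAC /moment !exprD trmx_mul trmx_exp //.
  by rewrite -![_ * _]/(_ *m _) -!mulmxA.
have g0 : g = 0.
  rewrite -fU; apply/polyP => k; rewrite coef_map coef0 coef_poly.
  by case: ltnP => [/u_even|_]; [rewrite f_eq0 => /eqP | rewrite raddf0].
have := congr1 (fun M : 'cV_n.+1 => M i 0) Eg.
by rewrite g0 raddf0 mul0mx !mxE f_eq0 => ->.
Qed.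

End GramMod2.

(** * The discriminant *)

Lemma horner_char_poly (R : comNzRingType) n (B : 'M[R]_n) b :
  (char_poly B).[b] = \det (b%:M - B).
Proof.
rewrite -[LHS]/(horner_eval b _) -det_map_mx; congr (\det _).
apply/matrixP => i j; rewrite !mxE /= /horner_eval hornerD hornerN hornerC.
by rewrite hornerMn hornerX.
Qed.

(** Both sides are multiplicative in [p], which reduces to linear [p]. *)
Lemma det_horner_mx (F : closedFieldType) n (B : 'M[F]_n.+1) (a : seq F) p :
    char_poly B = \prod_(z <- a) ('X - z%:P) ->
  \det (horner_mx B p) = \prod_(z <- a) p.[z].
Proof.
move=> chiB; have sza : size a = n.+1.
  by have := size_char_poly B; rewrite chiB size_prod_XsubC => -[].
have prod_cst c : \prod_(z <- a) c = c ^+ n.+1.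
  by rewrite big_const_seq count_predT sza iter_mulr_1.
have detXsubC b : \det (horner_mx B ('X - b%:P)) = \prod_(z <- a) (z - b).
  rewrite rmorphB /= horner_mx_X horner_mx_C -opprB -scaleN1r detZ.
  rewrite -horner_char_poly chiB horner_prod -prod_cst -big_split /=.
  by apply: eq_bigr => z _; rewrite hornerXsubC; ring.
have [s ->] := closed_field_poly_normal p.
move: (lead_coef p) => c.
rewrite linearZ /= detZ -prod_cst.
under [RHS]eq_bigr do rewrite hornerZ horner_prod.
rewrite big_split /=; congr (_ * _); rewrite exchange_big /=.
elim: s => [|b s IH]; first by rewrite !big_nil rmorph1 det1.
rewrite !big_cons rmorphM /= det_mulmx IH detXsubC; congr (_ * _).
by apply: eq_bigr => z _; rewrite hornerXsubC.
Qed.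

Lemma prod_ltn (R : comNzRingType) n (F : nat -> nat -> R) :
  \prod_(j < n) \prod_(i < j) F i j = \prod_(j < n) \prod_(i < n | (i < j)%N) F i j.
Proof.
apply: eq_bigr => j _.
by rewrite (big_ord_widen n (fun i => F i j)); last exact/ltnW.
Qed.

Section Discriminant.
Variables (n : nat) (G : sgraph n.+1).
Let A := adjacency G.
Let a := eigenvalues A.
Let sza : size a = n.+1. Proof. exact: size_eigenvalues. Qed.

Lemma adjacency_diag u : A u u = 0.
Proof. by rewrite mxE edge_irr. Qed.

(** The Gram matrix of the Vandermonde matrix of the eigenvalues consists of
    their power sums. *)
Lemma discriminant_trace :
  discriminant A = \det (\matrix_(i < n.+1, j < n.+1) \tr (A ^+ (i + j))).
Proof.
apply: (@intr_inj algC); rewrite discriminantE -/a -det_map_mx.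
pose V := Vandermonde n.+1 (\row_(i < n.+1) a`_i).
transitivity (\det (V *m V^T)); last first.
  congr (\det _); apply/matrixP=> i j.
  transitivity ((\tr (A ^+ (i + j)))%:~R : algC); last first.
    by rewrite [RHS]mxE /=; congr (_%:~R); rewrite mxE.
  rewrite mxE -adjacency_trace -/a [RHS](big_nth 0) sza big_mkord.
  by apply: eq_bigr => k _; rewrite !mxE exprD.
rewrite det_mulmx det_tr det_Vandermonde -expr2.
rewrite (prod_ltn _ (fun i j => (a`_i - a`_j) ^+ 2)).
rewrite (exchange_big_dep predT) //= -prodrXl; apply: eq_bigr => j _.
by rewrite -prodrXl; apply: eq_bigr => i _; rewrite !mxE -opprB sqrrN.
Qed.

(** The resultant formula: the determinant is the product of the values of the
    derivative of the characteristic polynomial at the eigenvalues. *)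
Lemma discriminant_det_deriv :
  exists k : nat,
    discriminant A = (-1) ^+ k * \det (horner_mx A (char_poly A)^`()).
Proof.
exists (\sum_(j < n.+1) j)%N; apply: (@intr_inj algC).
rewrite rmorphM rmorphXn rmorphN1 /= discriminantE -/a -det_map_mx map_horner_mx.
have chiA : char_poly (map_mx intr A) = \prod_(z <- a) ('X - z%:P).
  by rewrite -map_char_poly eigenvaluesE.
rewrite (det_horner_mx _ chiA) [X in _ * X](big_nth 0) sza big_mkord.
have -> : map_poly intr (char_poly A)^`() =
    (\prod_(j < n.+1) ('X - (a`_j)%:P))^`().
  by rewrite -deriv_map (eigenvaluesE A) -/a (big_nth 0) sza big_mkord.
pose r (i j : 'I_n.+1) : algC := a`_i - a`_j.
have dE (i : 'I_n.+1) : (\prod_(j < n.+1) ('X - (a`_j)%:P))^`().[a`_i] =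
    (\prod_(j < n.+1 | (j < i)%N) r i j) * \prod_(j < n.+1 | (i < j)%N) r i j.
  rewrite (bigD1 i) //= derivM derivXsubC mul1r hornerD hornerM.
  rewrite hornerXsubC subrr mul0r addr0 horner_prod.
  rewrite (bigID (fun j : 'I_n.+1 => (j < i)%N)) /=; congr (_ * _).
    apply: eq_big => [j|j _]; last by rewrite hornerXsubC.
    by rewrite -val_eqE /=; case: ltngtP.
  apply: eq_big => [j|j _]; last by rewrite hornerXsubC.
  by rewrite -val_eqE /=; case: ltngtP.
rewrite [X in _ * X](eq_bigr _ (fun i _ => dE i)).
rewrite big_split /= [X in _ * (_ * X)](exchange_big_dep predT) //= -big_split /=.
rewrite expr_sum -big_split /=.
rewrite (prod_ltn _ (fun i j => (a`_i - a`_j) ^+ 2)); apply: eq_bigr => j _.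
have -> : (-1) ^+ j = \prod_(i < n.+1 | (i < j)%N) -1 :> algC.
  rewrite -(big_ord_widen n.+1 (fun=> -1)); last exact/ltnW.
  by rewrite prodr_const card_ord.
rewrite -!big_split /=; apply: eq_bigr => i _; rewrite /r; ring.
Qed.

End Discriminant.

Lemma dvd2_discriminant n (G : sgraph n.+2) :
  (2 %| discriminant (adjacency G))%Z.
Proof.
rewrite discriminant_trace (expand_det_row _ 1).
apply: rpred_sum => j _; rewrite dvdz_mulr // mxE.
apply: dvd2_trace; [exact: adjacency_tr | exact: adjacency_diag].
Qed.

(** * Walk counts from the two spectra *)

Section Resolvent.
Variables (n : nat) (A : 'M[int]_n).
Let e : 'cV[int]_n := const_mx 1.

(** A rank-one perturbation of the characteristic polynomial. By the matrix
    determinant lemma it is the numerator of the generating function of the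
    products of the all-ones vector with [A ^+ k *m w]. Defining it as a
    difference of characteristic polynomials makes its degree evident, while
    the other form [resolvent_numE] shows that it is linear in [w]. *)
Definition resolvent_num (w : 'cV[int]_n) : {poly int} :=
  char_poly (A - w *m e^T) - char_poly A.

Lemma size_resolvent_num w : (size (resolvent_num w) <= n)%N.
Proof.
apply/leq_sizeP => k; rewrite leq_eqVlt coefB => /orP[/eqP <-|ltnk].
  have := monicP (char_poly_monic (A - w *m e^T)).
  have := monicP (char_poly_monic A).
  by rewrite /lead_coef !size_char_poly /= => -> ->; rewrite subrr.
by rewrite !nth_default ?subrr ?size_char_poly.
Qed.

Lemma resolvent_numE w : resolvent_num w =
  (map_mx polyC e^T *m \adj (char_poly_mx A) *m map_mx polyC w) 0 0.
Proof.
have reg : GRing.rreg (\det (char_poly_mx A)).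
  by apply/rregP; rewrite monic_neq0 ?char_poly_monic.
have := det_sub_rank1 (- map_mx polyC w) (map_mx polyC e^T) reg.
rewrite /resolvent_num /char_poly mulNmx opprK mulmxN mxE opprK.
rewrite -map_mxM => E.
have -> : char_poly_mx (A - w *m e^T) = char_poly_mx A + map_mx polyC (w *m e^T).
  by rewrite /char_poly_mx map_mxB opprB addrA addrAC.
by rewrite E addrC addKr.
Qed.

Lemma resolvent_num_step w :
  resolvent_num (A *m w) = 'X * resolvent_num w - char_poly A * ((e^T *m w) 0 0)%:P.
Proof.
have mapA : map_mx polyC A = 'X%:M - char_poly_mx A by rewrite subKr.
rewrite !resolvent_numE map_mxM mapA mulmxBl mulmxBr.
rewrite mul_scalar_mx -scalemxAr mxE [X in X + _]mxE; congr (_ + _).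
rewrite mxE mulmxA -[_ *m \adj _ *m _]mulmxA mul_adj_mx mul_mx_scalar -scalemxAl.
by rewrite mxE -map_mxM [X in _ * X]mxE.
Qed.

Lemma iter_resolvent_num k : resolvent_num (A ^+ k.+1 *m e) =
  'X * resolvent_num (A ^+ k *m e) - char_poly A * (moment A k)%:P.
Proof.
rewrite exprS -[A * _]/(A *m _) -mulmxA resolvent_num_step.
by rewrite mulmxA.
Qed.

End Resolvent.

(** By [iter_resolvent_num] the moment of order [k] is the quotient of
    the polynomial [X] times the [k]-th numerator by the characteristic
    polynomial, with the next numerator as the remainder; so the first numerator
    and the characteristic polynomial determine all moments. *)
Lemma moment_determined n (A B : 'M[int]_n) :
    char_poly A = char_poly B ->
    char_poly (A - const_mx 1) = char_poly (B - const_mx 1) ->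
  moment A =1 moment B.
Proof.
move=> chiAB chiJ k; pose e : 'cV[int]_n := const_mx 1.
have step i : resolvent_num A (A ^+ i *m e) = resolvent_num B (B ^+ i *m e) ->
    moment A i = moment B i.
  move=> Ri; apply/eqP; rewrite -subr_eq0; apply/negPn/negP => d0.
  have := size_resolvent_num B (B ^+ i.+1 *m e).
  have := size_resolvent_num A (A ^+ i.+1 *m e).
  rewrite !iter_resolvent_num Ri chiAB.
  set R := 'X * _ => szA szB.
  have := size_polyD (R - char_poly B * (moment B i)%:P)
            (- (R - char_poly B * (moment A i)%:P)).
  have -> : R - char_poly B * (moment B i)%:P +
        - (R - char_poly B * (moment A i)%:P) =
      (moment A i - moment B i) *: char_poly B.
    by rewrite -mul_polyC polyCB; ring.
  rewrite size_scale // size_char_poly size_polyN leqNgt => /negP[].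
  by rewrite ltnS geq_max szA szB.
suff R i : resolvent_num A (A ^+ i *m e) = resolvent_num B (B ^+ i *m e).
  exact/step/R.
elim: i => [|i IH].
  rewrite !expr0 !mul1mx /resolvent_num chiAB; congr (_ - _).
  suff -> : e *m e^T = const_mx 1 by [].
  by apply/matrixP => a b; rewrite !mxE big_ord1 !mxE mulr1.
by rewrite !iter_resolvent_num IH (step _ IH) chiAB.
Qed.

Lemma spectrum_char_poly n m (A : 'M[int]_n) (B : 'M[int]_m) :
  perm_eq (eigenvalues A) (eigenvalues B) -> char_poly A = char_poly B.
Proof.
move=> AB; apply: (map_inj_poly (@intr_inj algC) (rmorph0 _)).
by rewrite !eigenvaluesE; apply: perm_big.
Qed.

(** The adjacency matrix of the complement is [J - 1 - A], with [J] the
    all-ones matrix; hence the substitution of [- 'X - 1]. *)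
Lemma char_poly_compl n (G : sgraph n) :
  char_poly (adjacency (compl G)) \Po (- 'X - 1) =
  (-1) ^+ n * char_poly (adjacency G - const_mx 1).
Proof.
rewrite -[LHS]/(comp_poly _ _) -det_map_mx -detZ; congr (\det _).
apply/matrixP => i j; rewrite !mxE /= raddfB raddfMn /= comp_polyC.
rewrite comp_polyX /compl_edge; case: eqVneq => [->|_] /=; last first.
  by case: (edge G i j) => /=; rewrite ?polyCB ?polyC0 ?polyC1 ?mulr0n; ring.
by rewrite edge_irr /= !mulr1n ?polyCB ?polyC0 ?polyC1; ring.
Qed.

Lemma char_poly_sub_ones n (G H : sgraph n) :
    char_poly (adjacency (compl G)) = char_poly (adjacency (compl H)) ->
  char_poly (adjacency G - const_mx 1) = char_poly (adjacency H - const_mx 1).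
Proof.
move=> E; have sgn0 : (-1) ^+ n != 0 :> {poly int} by rewrite signr_eq0.
by apply: (mulfI sgn0); rewrite -!char_poly_compl E.
Qed.

(** * From generalized cospectrality to isomorphism *)

(** [Q := V W^-1] maps each Krylov vector of [B] to that of [A]. It is
    orthogonal, and carries [A] to [B], because the Gram matrices of the Krylov
    vectors, and those of the forms of [A] and [B], consist of moments. Clearing
    denominators with the adjugate gives [N]; the sign makes [l] positive. *)
Lemma krylov_intertwiner n (A B : 'M[int]_n.+1) :
    A^T = A -> B^T = B -> moment A =1 moment B ->
    \det (krylov A (const_mx 1)) != 0 ->
  exists l N, (0 < l)%N /\ intertwiner A B l N.
Proof.
move=> Asym Bsym mAB; set e : 'cV[int]_n.+1 := const_mx 1.
set V := krylov A e; pose W := krylov B e => detV0.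
have gram : V^T *m V = W^T *m W.
  by rewrite !krylov_gram //; apply/matrixP => i j; rewrite !mxE mAB.
have gramA : V^T *m A *m V = W^T *m B *m W.
  have gramS C : C^T = C -> (krylov C e)^T *m C *m krylov C e =
      \matrix_(i, j) moment C (i + j).+1.
    move=> Csym; apply/matrixP => i j; rewrite [RHS]mxE.
    have -> : moment C (i + j).+1 = ((C ^+ i *m e)^T *m C *m (C ^+ j *m e)) 0 0.
      rewrite trmx_mul trmx_exp // /moment -addnS exprD exprS.
      by rewrite -![_ * _]/(_ *m _) -!mulmxA.
    have rowE' : row i (krylov C e)^T = (C ^+ i *m e)^T.
      by apply/rowP => u; rewrite !mxE.
    have colE' : col j (krylov C e) = C ^+ j *m e.
      by apply/colP => u; rewrite !mxE.
    by rewrite -rowE' -colE' -row_mul -col_mulmx -row_mul [RHS]mxE [RHS]mxE.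
  by rewrite !gramS //; apply/matrixP => i j; rewrite !mxE mAB.
have detW0 : \det W != 0.
  have := congr1 determinant gram; rewrite !det_mulmx !det_tr => E.
  by apply: contraNneq detV0 => W0; rewrite -[_ == 0]orbb -mulf_eq0 E W0 mulr0.
pose l := `|\det W|%N; pose X := sgz (\det W) *: \adj W; pose N := V *m X.
have sW : sgz (\det W) * \det W = l%:R by rewrite natz -abszEsg.
have WX : W *m X = l%:R%:M.
  by rewrite -scalemxAr mul_mx_adj scale_scalar_mx sW.
have XW : X *m W = l%:R%:M.
  by rewrite -scalemxAl mul_adj_mx scale_scalar_mx sW.
have conjN C D : V^T *m C *m V = W^T *m D *m W -> N^T *m C *m N = (l ^ 2)%:R *: D.
  move=> CD; have -> : N^T *m C *m N = X^T *m (V^T *m C *m V) *m X.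
    by rewrite /N trmx_mul !mulmxA.
  have -> : X^T *m (V^T *m C *m V) *m X = (W *m X)^T *m D *m (W *m X).
    by rewrite CD trmx_mul !mulmxA.
  by rewrite WX tr_scalar_mx mul_scalar_mx mul_mx_scalar scalerA natrX.
have NtN : N^T *m N = (l ^ 2)%:R%:M.
  by rewrite -{1}[N^T]mulmx1 (conjN _ 1%:M) ?mulmx1 // scale_scalar_mx mulr1.
have l2 : (l ^ 2)%:R != 0 :> int.
  by rewrite pnatr_eq0 expn_eq0 absz_eq0 (negPf detW0).
have col0 C : krylov C e *m delta_mx 0 0 = e.
  by rewrite -colE; apply/colP => u; rewrite mxE [LHS]mxE expr0 mul1mx.
exists l, N; rewrite absz_gt0 detW0; split=> //; split=> //.
  have := congr1 (mulmx N) (conjN _ _ gramA).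
  rewrite -[N^T *m A *m N]mulmxA mulmxA (mulmx_tr_scalar l2 NtN) mul_scalar_mx.
  rewrite -scalemxAr => /matrixP E; apply/matrixP => i j; apply: (mulfI l2).
  by have := E i j; rewrite !mxE.
by rewrite -/e -{1}(col0 B) -/W /N -mulmxA [X *m _]mulmxA XW mul_scalar_mx
   -scalemxAr col0.
Qed.

(** Removing one prime of [l] at a time replaces the passage to the least
    denominator of [Q]. *)
Lemma intertwiner_descent n (A B : 'M[int]_n) :
    (forall p l N, prime p -> (p %| l)%N -> (0 < l)%N -> intertwiner A B l N ->
      forall i j, (p %| N i j)%Z) ->
  forall l N, (0 < l)%N -> intertwiner A B l N -> exists N1, intertwiner A B 1 N1.
Proof.
move=> div l; have [m] := ubnP l; elim: m l => // m IH l lm N l_gt0 Nint.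
have [l1|l1] := leqP l 1.
  by exists N; have <- : l = 1%N by apply/eqP; rewrite eqn_leq l1.
have p_pr := pdiv_prime l1; have p_gt1 := prime_gt1 p_pr.
have /dvdnP[k Ek] := pdiv_dvd l.
have pN := div _ _ _ p_pr (pdiv_dvd l) l_gt0 Nint.
move: (pdiv l) p_pr p_gt1 Ek pN => p p_pr p_gt1 Ek pN.
have p0 : p%:R != 0 :> int by rewrite pnatr_eq0 -lt0n prime_gt0.
pose N' := \matrix_(i, j) (N i j %/ p)%Z.
have EN : N = p%:R *: N'.
  by apply/matrixP => i j; rewrite !mxE mulrC natz divzK.
have k_gt0 : (0 < k)%N by move: l_gt0; rewrite Ek muln_gt0 => /andP[].
have scaleI r s (X Y : 'M[int]_(r, s)) : p%:R *: X = p%:R *: Y -> X = Y.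
  move=> /matrixP E; apply/matrixP => i j; apply: (mulfI p0).
  by have := E i j; rewrite !mxE.
apply: (IH k _ N') => //.
  by rewrite -ltnS (leq_trans _ lm) // ltnS Ek ltn_Pmulr.
case: Nint => NtN AN Ne; split.
- apply: (@scaleI); apply: (@scaleI).
  rewrite scalemxAl scalemxAr -linearZ /= -EN NtN Ek.
  by rewrite !scale_scalar_mx expnMn natrM !natrX; congr (_%:M); ring.
- by apply: (@scaleI); rewrite scalemxAr scalemxAl -EN.
- by apply: (@scaleI); rewrite scalemxAl -EN Ne Ek scalerA natrM mulrC.
Qed.

(** The entries of a row of [N] and their squares both sum to 1, so they are 0 or
    1; an orthogonal matrix with such entries is a permutation matrix. *)
Lemma intertwiner1_isomorphic n (G H : sgraph n) (N : 'M[int]_n) :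
  intertwiner (adjacency G) (adjacency H) 1 N -> isomorphic H G.
Proof.
case; rewrite exp1n scale1r => NtN AN Ne.
have NNt : N *m N^T = 1%:M by apply: mulmx_tr_scalar NtN.
have rowsum i : \sum_j N i j = 1.
  have := congr1 (fun M : 'cV_n => M i 0) Ne; rewrite !mxE => <-.
  by apply: eq_bigr => j _; rewrite mxE mulr1.
have rowsq i : \sum_j N i j * N i j = 1.
  have := congr1 (fun M : 'M_n => M i i) NNt; rewrite !mxE eqxx mulr1n => <-.
  by apply: eq_bigr => j _; rewrite mxE.
have colsq j k : \sum_i N i j * N i k = (j == k)%:R.
  have := congr1 (fun M : 'M_n => M j k) NtN; rewrite !mxE => <-.
  by apply: eq_bigr => i _; rewrite mxE.
have N01 i j : N i j = 0 \/ N i j = 1.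
  have pos k : 0 <= N i k * N i k - N i k by nia.
  have : \sum_k (N i k * N i k - N i k) == 0.
    by rewrite sumrB rowsq rowsum subrr.
  rewrite psumr_eq0 => [/allP/(_ j)|k _]; last exact: pos.
  rewrite mem_index_enum => /(_ isT) /=; nia.
have N_ge0 i j : 0 <= N i j by case: (N01 i j) => ->.
have colN j : {i | N i j == 1}.
  apply: sigW; apply/existsP; apply: contraT; rewrite negb_exists => /forallP Nj.
  have := colsq j j; rewrite eqxx big1 // => i _.
  by case: (N01 i j) => E; [rewrite E mul0r | have := Nj i; rewrite E eqxx].
pose f j := sval (colN j).
have Nf j : N (f j) j = 1 by apply/eqP; rewrite /f; case: (colN j).
have orth i j k : j != k -> N i j = 1 -> N i k = 0.
  move=> jk Nij; have := colsq j k; rewrite (negPf jk) => /eqP.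
  rewrite psumr_eq0 => [/allP/(_ i)|x _]; last exact: mulr_ge0.
  by rewrite mem_index_enum => /(_ isT) /=; rewrite Nij mul1r => /eqP.
have finj : injective f.
  move=> j k fjk; apply/eqP/negPn/negP => jk.
  by have := orth _ _ _ jk (Nf j); rewrite fjk Nf.
have [g gK fK] : bijective f := injF_bij finj.
have NE i j : N i j = (i == f j)%:R.
  have [->|ij] := eqVneq; first exact: Nf.
  apply: (orth i (g i)); last by rewrite -{1}(fK i) Nf.
  by apply: contraNneq ij => <-; rewrite fK.
exists f; first by exists g.
move=> u v; have := congr1 (fun M : 'M_n => M (f u) v) AN; rewrite /= !mxE.
rewrite (bigD1 (f v)) //= NE eqxx mulr1 [X in _ + X]big1 ?addr0; last first.
  by move=> i /negPf ifv; rewrite NE ifv mulr0.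
rewrite (bigD1 u) //= NE eqxx mul1r [X in _ + X]big1 ?addr0; last first.
  by move=> i iu; rewrite NE (inj_eq finj) eq_sym (negPf iu) mul0r.
by rewrite !mxE; case: (edge G _ _); case: (edge H _ _).
Qed.

Theorem theorem1p5 (n : nat) (G : sgraph n) :
  let d := gcdn `|walk_quotient G|%N `|discriminant (adjacency G)|%N in
  odd d -> squarefree d -> dgs G.
Proof.
move=> d d_odd d_sqf m H specGH specGHc.
have nm : n = m.
  by rewrite -(size_eigenvalues (adjacency G)) (perm_size specGH) size_eigenvalues.
subst m; case: n => [|[|n]] in G d d_odd d_sqf H specGH specGHc *.
- by exists id => [|[]]; first by exists id.
- exists id => [|u v]; first by exists id.
  by rewrite !ord1 !edge_irr.
pose A := adjacency G; pose B := adjacency H.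
have Asym : A^T = A by apply: adjacency_tr.
have Bsym : B^T = B by apply: adjacency_tr.
have chiAB : char_poly A = char_poly B by apply: spectrum_char_poly.
have mAB : moment A =1 moment B.
  apply: moment_determined => //.
  exact/char_poly_sub_ones/spectrum_char_poly.
set q := walk_quotient G in d d_odd d_sqf.
have detW : \det (krylov A (const_mx 1)) = 2 ^+ n.+2./2 * q.
  by rewrite mulrC divzK //; apply: det_walk_matrix_dvd.
(* The discriminant is even, so the odd [d] can only come from [q]. *)
have q_odd : ~~ (2 %| q)%Z.
  apply/negP => q2; have := dvd2_discriminant G.
  rewrite !dvdzE /= in q2 * => D2.
  by move: d_odd; rewrite -[odd d]negbK -dvdn2 dvdn_gcd q2 D2.
have detW0 : \det (krylov A (const_mx 1)) != 0.
  by rewrite detW mulf_neq0 ?expf_neq0 //; apply: contraNneq q_odd => ->.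
have [l [N [l_gt0 Nint]]] := krylov_intertwiner Asym Bsym mAB detW0.
have [|N1] := intertwiner_descent _ l_gt0 Nint; last exact: intertwiner1_isomorphic.
move=> p {}l {}N p_pr pl {}l_gt0 {}Nint i j.
have [p2|p_odd] := even_prime p_pr.
  rewrite {}p2 in pl *.
  exact: (even_level_dvd2 Asym (@adjacency_diag _ G) Bsym l_gt0 Nint pl detW q_odd).
apply: contraT => Nij.
have := prime_sq_dvd_det_krylov Asym Bsym l_gt0 Nint p_pr pl Nij chiAB.
have := prime_sq_dvd_det_deriv Asym Bsym l_gt0 Nint p_pr pl Nij chiAB.
have [k ED] := discriminant_det_deriv G.
rewrite detW Gauss_dvdzr; last first.
  rewrite coprimezE !abszX coprimeXl ?coprimeXr // coprime_sym.
  by rewrite prime_coprime // dvdn2 p_odd.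
move=> pD pq.
have pd : (p ^ 2 %| d)%N.
  rewrite dvdn_gcd; move: pq; rewrite dvdzE abszX => -> /=.
  by move: pD; rewrite ED abszM abszX exp1n mul1n dvdzE abszX.
by have := d_sqf p pd; move: p_pr => /[swap] ->.
Qed.
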